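(* Let $A:\mathbb{R}^n\to\mathbb{R}^m$ be linear, let $f:\mathbb{R}^n\to\mathbb{R}\cup\{\infty\}$ be proper, closed and strongly convex with modulus $\mu_f>0$, let $g:\mathbb{R}^m\to\mathbb{R}\cup\{\infty\}$ be proper, closed and convex, with $A\,\mathrm{dom}\, f\cap\mathrm{dom}\, g\neq\emptyset$. Let $x_\star$ be the unique minimizer of $f+g\circ A$ and let $\psi(y)=f^*(-A^\top y)+g^*(y)$. Suppose that $\psi$ has a (unique) strong minimizer $y_\star$ and that, with respect to the primal-dual solution $(x_\star,y_\star)$: (a) $f$ is strictly twice epi-differentiable at all $x\in\mathrm{dom}\, f$ close enough to $x_\star$, and its second-order epi-derivative at $x_\star$ for $-A^\top y_\star$ is $w\mapsto\langle H_fw,w\rangle+\delta_{S_f}(w)$, with $S_f\subseteq\mathbb{R}^n$ a linear subspace and $H_f\in\mathbb{R}^{n\times n}$ symmetric positive semidefinite, $\mathrm{range}(H_f)=S_f$, $\ker(H_f)=S_f^\perp$; (b) $g$ is twice epi-differentiable at $Ax_\star$ for $y_\star$, with second-order epi-derivative $w\mapsto\langle H_gw,w\rangle+\delta_{S_g}(w)$, with $S_g\subseteq\mathbb{R}^m$ a linear subspace and $H_g\in\mathbb{R}^{m\times m}$ symmetric positive semidefinite, $\mathrm{range}(H_g)\subseteq S_g$, $\ker(H_g)\supseteq S_g^\perp$. Let $(x^k),(y^k),(d^k),(\tau_k)$ be generated by the algorithm NAMA (described in the context), with $\gamma\in(0,\mu_f/\|A\|^2)$, $\beta\in(0,1)$,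 $y^0\in\mathbb{R}^m$, and suppose that the directions satisfy $$\lim_{k\to\infty}\frac{\|y^k+d^k-y_\star\|}{\|y^k-y_\star\|}=0 .$$ Then: (i) $\tau_k=1$ for all $k$ sufficiently large; (ii) $\psi(y^k)\to\inf\psi$ Q-superlinearly; (iii) $y^k\to y_\star$ Q-superlinearly; (iv) $x^k\to x_\star$ R-superlinearly.
   Context: $A^\top$ is the adjoint; $\|A\|$ the operator norm; $h^*$ the Fenchel conjugate; $\delta_S$ the indicator function of $S$ ($0$ on $S$, $\infty$ elsewhere); strong convexity of $f$ with modulus $\mu_f$ means $f-\frac{\mu_f}{2}\|\cdot\|^2$ is convex. $y_\star$ is a strong minimizer of $\psi$ if for some $\alpha>0$, $\alpha\|y-y_\star\|^2\le\psi(y)-\psi(y_\star)$ for all $y$ sufficiently close to $y_\star$. Twice epi-differentiability: $h$ is twice epi-differentiable at $x$ for $v$ if the quotients $d\mapsto\frac{h(x+\tau d)-h(x)-\tau\langle v,d\rangle}{\tau^2/2}$ epi-converge (epigraphs converge in the Painlevé–Kuratowski sense) as $\tau\searrow0$; the limit function of $d$ is the second-order epi-derivative of $h$ at $x$ for $v$. It is strictly twice epi-differentiable at $x$ for $v$ if the quotients $d\mapsto\frac{h(\bar x+\tau d)-h(\bar x)-\tau\langle\bar v,d\rangle}{\tau^2/2}$ epi-converge as $\tau\searrow0$, $\bar x\to x$, $\bar v\to v$ (with $\bar v\in\partial h(\bar x)$). ''Strictly twice epi-differentiable at $x$'' without mention of $v$ means for every $v\in\partial f(x)$. Augmented Lagrangian: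 $\mathcal{L}_\gamma(x,z,y)=f(x)+g(z)+\langle y,Ax-z\rangle+\frac{\gamma}{2}\|Ax-z\|^2$. Algorithm NAMA. Given $y^0\in\mathbb{R}^m$, $\gamma\in(0,\mu_f/\|A\|^2)$, $\beta\in(0,1)$, for $k=0,1,2,\dots$: 1. $x^k=\arg\min_x\{f(x)+\langle y^k,Ax\rangle\}$, $z^k=\arg\min_z\mathcal{L}_\gamma(x^k,z,y^k)$. 2. Choose a direction $d^k\in\mathbb{R}^m$. 3. Find the largest $\tau_k=\beta^{i_k}$, $i_k\in\{0,1,2,\dots\}$, such that $\mathcal{L}_\gamma(\tilde x^k,\tilde z^k,\tilde y^k)\ge\mathcal{L}_\gamma(x^k,z^k,y^k)$, where $\tilde y^k=y^k+\tau_kd^k+\gamma(1-\tau_k)(Ax^k-z^k)$, $\tilde x^k=\arg\min_x\{f(x)+\langle\tilde y^k,Ax\rangle\}$, $\tilde z^k=\arg\min_z\mathcal{L}_\gamma(\tilde x^k,z,\tilde y^k)$. 4. $y^{k+1}=\tilde y^k+\gamma(A\tilde x^k-\tilde z^k)$. Such a $\tau_k$ exists whenever $Ax^k\neq z^k$; if $Ax^k=z^k$ then $(x^k,y^k)$ is already a primal-dual solution. The statement concerns infinite sequences with $Ax^k\neq z^k$ (equivalently $y^k\ne y_\star$) for all $k$. Rates: $a_k\ge0$ tends to $0$ Q-superlinearly if $a_{k+1}/a_k\to0$ (applied to $\psi(y^k)-\inf\psi$ and to $\|y^k-y_\star\|$); $x^k\to x_\star$ R-superlinearly if $\|x^k-x_\star\|$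 is bounded by a sequence converging Q-superlinearly to $0$. *)

(* Defs.v *)
From HB Require Import structures.
From mathcomp Require Import all_boot all_order all_algebra.
From mathcomp Require Import all_classical all_reals all_analysis.

Set Implicit Arguments.
Unset Strict Implicit.
Unset Printing Implicit Defensive.

Import Order.TTheory GRing.Theory Num.Theory.
Import numFieldNormedType.Exports.

Local Open Scope classical_set_scope.
Local Open Scope ring_scope.

Section Euclidean.
Variable R : realType.

Definition dotv n (u v : 'cV[R]_n) : R := \sum_i u i ord0 * v i ord0.

(* The norm of the normed-module structure of the library on matrices is the
   sup norm; it induces the same topology as the Euclidean norm, so [nbhs] and
   [closed] can be used as they are. *)
Definition enorm n (u : 'cV[R]_n) : R := Num.sqrt (dotv u u).

Definition opnorm m n (A : 'M[R]_(m, n)) : R :=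
  sup [set enorm (A *m x) | x in [set x : 'cV[R]_n | enorm x <= 1]].

Definition psd n (H : 'M[R]_n) : Prop :=
  H^T = H /\ forall w : 'cV[R]_n, 0 <= dotv (H *m w) w.

Definition orthogonal_set n (S : {vspace 'cV[R]_n}) : set 'cV[R]_n :=
  [set w | forall u, u \in S -> dotv w u = 0].

End Euclidean.

Section ExtendedRealFunctions.
Variable R : realType.
Local Open Scope ereal_scope.

Definition edom (T : Type) (h : T -> \bar R) : set T := [set x | h x < +oo].

Definition proper_fun (T : Type) (h : T -> \bar R) : Prop :=
  (forall x, h x != -oo) /\ edom h !=set0.

Definition epi (T : Type) (h : T -> \bar R) : set (T * R) :=
  [set p | h p.1 <= p.2%:E].

Definition closed_fun n (h : 'cV[R]_n -> \bar R) : Prop := closed (epi h).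

Definition convex_fun n (h : 'cV[R]_n -> \bar R) : Prop :=
  forall (x y : 'cV[R]_n) (t : R), (0 < t < 1)%R ->
    h (t *: x + (1 - t) *: y)%R <= t%:E * h x + (1 - t)%:E * h y.

Definition strongly_convex n (mu : R) (h : 'cV[R]_n -> \bar R) : Prop :=
  convex_fun (fun x => h x - (mu / 2 * enorm x ^+ 2)%:E).

Definition argmin (T : Type) (h : T -> \bar R) : set T :=
  [set x | forall z, h x <= h z].

Definition conjugate n (h : 'cV[R]_n -> \bar R) (v : 'cV[R]_n) : \bar R :=
  ereal_sup (range (fun x => (dotv v x)%:E - h x)).

Definition subdiff n (h : 'cV[R]_n -> \bar R) (x : 'cV[R]_n) : set 'cV[R]_n :=
  [set v | h x \is a fin_num /\
           forall z, h x + (dotv v (z - x)%R)%:E <= h z].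

Definition strong_minimizer n (h : 'cV[R]_n -> \bar R) (x : 'cV[R]_n) : Prop :=
  h x \is a fin_num /\
  exists2 alpha : R, (0 < alpha)%R &
    \forall z \near x, (alpha * enorm (z - x) ^+ 2)%:E <= h z - h x.

Definition quad_ind n (H : 'M[R]_n) (S : {vspace 'cV[R]_n}) (w : 'cV[R]_n) :
    \bar R :=
  (dotv (H *m w) w)%:E + (if w \in S then 0 else +oo).

End ExtendedRealFunctions.

Section EpiDifferentiability.

(* Painleve-Kuratowski limits of a family of sets along a filter. *)
Definition PK_liminf (T : Type) (U : topologicalType) (F : set_system T)
    (C : T -> set U) : set U :=
  [set u | forall V, nbhs u V -> \forall t \near F, C t `&` V !=set0].

Definition PK_limsup (T : Type) (U : topologicalType) (F : set_system T)
    (C : T -> set U) : set U :=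
  [set u | forall V, nbhs u V ->
           forall P, F P -> exists2 t, P t & C t `&` V !=set0].

Definition PK_cvg (T : Type) (U : topologicalType) (F : set_system T)
    (C : T -> set U) (L : set U) : Prop :=
  PK_liminf F C = L /\ PK_limsup F C = L.

Variable R : realType.

Definition epi_cvg (T : Type) n (F : set_system T)
    (h : T -> 'cV[R]_n -> \bar R) (q : 'cV[R]_n -> \bar R) : Prop :=
  PK_cvg F (fun t => epi (h t) : set ('cV[R]_n * R)%type) (epi q).

Definition quotient2 n (h : 'cV[R]_n -> \bar R) (x v : 'cV[R]_n) (tau : R)
    (d : 'cV[R]_n) : \bar R :=
  ((h (x + tau *: d)%R - h x - (tau * dotv v d)%:E)
     * ((tau ^+ 2 / 2)^-1)%:E)%E.

Definition second_epi_derivative n (h : 'cV[R]_n -> \bar R)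
    (x v : 'cV[R]_n) (q : 'cV[R]_n -> \bar R) : Prop :=
  h x \is a fin_num /\ epi_cvg (0 : R)^'+ (quotient2 h x v) q.

Definition strict_base n (h : 'cV[R]_n -> \bar R) (x v : 'cV[R]_n) :
    set_system ('cV[R]_n * 'cV[R]_n * R)%type :=
  filter_prod (within [set p | subdiff h p.1 p.2] (nbhs (x, v))) (0 : R)^'+.

Definition strictly_twice_epi_diff_for n (h : 'cV[R]_n -> \bar R)
    (x v : 'cV[R]_n) : Prop :=
  h x \is a fin_num /\
  exists q, epi_cvg (strict_base h x v)
                    (fun p => quotient2 h p.1.1 p.1.2 p.2) q.

Definition strictly_twice_epi_diff n (h : 'cV[R]_n -> \bar R)
    (x : 'cV[R]_n) : Prop :=
  forall v, subdiff h x v -> strictly_twice_epi_diff_for h x v.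

End EpiDifferentiability.

Section Algorithm.
Variable R : realType.

Definition auglag n m (f : 'cV[R]_n -> \bar R) (g : 'cV[R]_m -> \bar R)
    (A : 'M[R]_(m, n)) (gamma : R) (x : 'cV[R]_n) (z y : 'cV[R]_m) : \bar R :=
  (f x + g z + (dotv y (A *m x - z)%R)%:E
     + (gamma / 2 * enorm (A *m x - z)%R ^+ 2)%:E)%E.

Definition dual_fun n m (f : 'cV[R]_n -> \bar R) (g : 'cV[R]_m -> \bar R)
    (A : 'M[R]_(m, n)) (y : 'cV[R]_m) : \bar R :=
  (conjugate f (- (A^T *m y))%R + conjugate g y)%E.

(* (x, z) are the primal points that the algorithm associates with y. *)
Definition primal_update n m (f : 'cV[R]_n -> \bar R) (g : 'cV[R]_m -> \bar R)
    (A : 'M[R]_(m, n)) (gamma : R) (y : 'cV[R]_m)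
    (x : 'cV[R]_n) (z : 'cV[R]_m) : Prop :=
  argmin (fun x' => f x' + (dotv y (A *m x'))%:E)%E x /\
  argmin (fun z' => auglag f g A gamma x z' y) z.

Definition trial_point n m (A : 'M[R]_(m, n)) (gamma : R) (x : 'cV[R]_n)
    (z y d : 'cV[R]_m) (tau : R) : 'cV[R]_m :=
  y + tau *: d + (gamma * (1 - tau)) *: (A *m x - z).

(* The minimizers at the trial point exist and are unique under the assumptions
   made on f and g, so the existential quantifiers only name them. *)
Definition accepted n m (f : 'cV[R]_n -> \bar R) (g : 'cV[R]_m -> \bar R)
    (A : 'M[R]_(m, n)) (gamma : R) (x : 'cV[R]_n) (z y d : 'cV[R]_m)
    (tau : R) : Prop :=
  let yt := trial_point A gamma x z y d tau in
  exists xt zt, primal_update f g A gamma yt xt zt /\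
    (auglag f g A gamma x z y <= auglag f g A gamma xt zt yt)%E.

Record nama n m (f : 'cV[R]_n -> \bar R) (g : 'cV[R]_m -> \bar R)
    (A : 'M[R]_(m, n)) (gamma beta : R) (x : nat -> 'cV[R]_n)
    (z y d : nat -> 'cV[R]_m) (tau : nat -> R)
    (xt : nat -> 'cV[R]_n) (zt yt : nat -> 'cV[R]_m) : Prop := {
  nama_primal : forall k, primal_update f g A gamma (y k) (x k) (z k);
  nama_tau_pow : forall k, exists i : nat, tau k = beta ^+ i;
  nama_tau_acc : forall k,
    accepted f g A gamma (x k) (z k) (y k) (d k) (tau k);
  nama_tau_max : forall k (j : nat),
    accepted f g A gamma (x k) (z k) (y k) (d k) (beta ^+ j) ->
    beta ^+ j <= tau k;
  nama_trial : forall k,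
    yt k = trial_point A gamma (x k) (z k) (y k) (d k) (tau k);
  nama_trial_primal : forall k, primal_update f g A gamma (yt k) (xt k) (zt k);
  nama_dual : forall k, y k.+1 = yt k + gamma *: (A *m xt k - zt k)
}.

End Algorithm.

Section Rates.
Variable R : realType.

(* Eventual positivity makes the quotients meaningful: without it, division by
   zero being zero, a sequence vanishing at every other index would qualify. *)
Definition Qsuperlinear (a : nat -> R) : Prop :=
  [/\ forall k, 0 <= a k,
      \forall k \near \oo, 0 < a k,
      a k @[k --> \oo] --> 0
    & a k.+1 / a k @[k --> \oo] --> 0].

Definition Rsuperlinear (a : nat -> R) : Prop :=
  exists2 b : nat -> R, Qsuperlinear b & forall k, a k <= b k.

End Rates.

(* Main.v *)
Require Import Defs.
From HB Require Import structures.
From mathcomp Require Import all_boot all_order all_algebra.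
From mathcomp Require Import all_classical all_reals all_analysis.
From mathcomp Require Import ring lra.

Set Implicit Arguments.
Unset Strict Implicit.
Unset Printing Implicit Defensive.

Import Order.TTheory GRing.Theory Num.Theory.
Import numFieldNormedType.Exports.

Local Open Scope classical_set_scope.
Local Open Scope ring_scope.

(** Let [phi y = - L_gamma (x y, z y, y)] be the alternating minimization
    envelope, [s = A x - z] the residual at [y] and [w = y + gamma s]. Fenchel's
    inequality gives [phi y <= psi u + |u - y|^2 / (2 gamma)] for all [u], and
    the optimality conditions defining [x] and [z] give
    [psi w <= phi y - c |s|^2]. As [psi] is convex, its strong minimizer yields
    quadratic growth near [ys] and linear growth far from it. The line search
    makes [phi (y k)] decrease by at least [c] times the squared residual at the
    trial point, hence [y k --> ys]. The two inequalities for [phi] sandwich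
    [phi - psi ys] near [ys] between two multiples of [|y - ys|^2]; so the
    superlinear directions are accepted with unit step without any second-order
    expansion of [phi], and the same sandwich transfers their rate to the
    iterates. *)

(** * Euclidean geometry *)

Section Dot.
Context {R : realType}.

Lemma dotvC n (u v : 'cV[R]_n) : dotv u v = dotv v u.
Proof. by apply: eq_bigr => i _; rewrite mulrC. Qed.

Lemma dotvDl n (u v w : 'cV[R]_n) : dotv (u + v) w = dotv u w + dotv v w.
Proof. by rewrite -big_split; apply: eq_bigr => i _; rewrite mxE mulrDl. Qed.

Lemma dotvZl n (a : R) (u w : 'cV[R]_n) : dotv (a *: u) w = a * dotv u w.
Proof. by rewrite mulr_sumr; apply: eq_bigr => i _; rewrite mxE mulrA. Qed.

Lemma dotvNl n (u w : 'cV[R]_n) : dotv (- u) w = - dotv u w.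
Proof. by rewrite -scaleN1r dotvZl mulN1r. Qed.

Lemma dotvDr n (u v w : 'cV[R]_n) : dotv w (u + v) = dotv w u + dotv w v.
Proof. by rewrite dotvC dotvDl !(dotvC w). Qed.

Lemma dotvZr n (a : R) (u w : 'cV[R]_n) : dotv w (a *: u) = a * dotv w u.
Proof. by rewrite dotvC dotvZl dotvC. Qed.

Lemma dotvNr n (u w : 'cV[R]_n) : dotv w (- u) = - dotv w u.
Proof. by rewrite dotvC dotvNl dotvC. Qed.

Definition dotvE := (dotvDl, dotvDr, dotvNl, dotvNr, dotvZl, dotvZr).

Lemma dotv_ge0 n (u : 'cV[R]_n) : 0 <= dotv u u.
Proof. by apply: sumr_ge0 => i _; rewrite -expr2 sqr_ge0. Qed.

Lemma dotv_trmx m n (A : 'M[R]_(m, n)) (y : 'cV[R]_m) (x : 'cV[R]_n) :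
  dotv (A^T *m y) x = dotv y (A *m x).
Proof.
have E k (u v : 'cV[R]_k) : dotv u v = (u^T *m v) ord0 ord0.
  by rewrite mxE; apply: eq_bigr => i _; rewrite mxE.
by rewrite !E trmx_mul trmxK mulmxA.
Qed.

Lemma enorm_ge0 n (u : 'cV[R]_n) : 0 <= enorm u.
Proof. exact: sqrtr_ge0. Qed.

Lemma enorm_sqr n (u : 'cV[R]_n) : enorm u ^+ 2 = dotv u u.
Proof. by rewrite sqr_sqrtr ?dotv_ge0. Qed.

Lemma dotv_eq0 n (u : 'cV[R]_n) : dotv u u = 0 -> u = 0.
Proof.
move=> /eqP; rewrite psumr_eq0 => [/allP h|i _]; last by rewrite -expr2 sqr_ge0.
apply/matrixP => i j; rewrite ord1 mxE; apply/eqP.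
by have := h i (mem_index_enum i); rewrite /= mulf_eq0 orbb.
Qed.

Lemma enorm_eq0 n (u : 'cV[R]_n) : enorm u = 0 -> u = 0.
Proof. by move=> u0; apply: dotv_eq0; rewrite -enorm_sqr u0 expr0n. Qed.

Lemma enormZ n (a : R) (u : 'cV[R]_n) : enorm (a *: u) = `|a| * enorm u.
Proof.
by rewrite /enorm dotvZl dotvZr mulrA -expr2 sqrtrM ?sqr_ge0// sqrtr_sqr.
Qed.

Lemma enormN n (u : 'cV[R]_n) : enorm (- u) = enorm u.
Proof. by rewrite -scaleN1r enormZ normrN1 mul1r. Qed.

(** Cauchy-Schwarz: expand the square of [|v| u - |u| v] and divide by [|u| |v|]. *)
Lemma dotv_le_enorm n (u v : 'cV[R]_n) : dotv u v <= enorm u * enorm v.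
Proof.
have [/enorm_eq0 ->|u0] := eqVneq (enorm u) 0.
  have ->: dotv (0 : 'cV[R]_n) v = 0 by rewrite -(scale0r 0) dotvZl mul0r.
  by rewrite mulr_ge0 ?enorm_ge0.
have [/enorm_eq0 ->|v0] := eqVneq (enorm v) 0.
  have ->: dotv u (0 : 'cV[R]_n) = 0 by rewrite -(scale0r 0) dotvZr mul0r.
  by rewrite mulr_ge0 ?enorm_ge0.
have up : 0 < enorm u by rewrite lt0r u0 enorm_ge0.
have vp : 0 < enorm v by rewrite lt0r v0 enorm_ge0.
have := dotv_ge0 (enorm v *: u - enorm u *: v).
rewrite !dotvE -!enorm_sqr (dotvC v u) => h.
have uv : 0 < enorm u * enorm v by rewrite mulr_gt0.
rewrite -(ler_pM2l uv); nra.
Qed.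

Lemma enorm_triangle n (u v : 'cV[R]_n) : enorm (u + v) <= enorm u + enorm v.
Proof.
rewrite -(@ler_pXn2r _ 2) ?nnegrE ?addr_ge0 ?enorm_ge0// enorm_sqr !dotvE.
by rewrite sqrrD !enorm_sqr (dotvC v u); have := dotv_le_enorm u v; lra.
Qed.

Lemma enormB n (u v : 'cV[R]_n) : enorm (u - v) = enorm (v - u).
Proof. by rewrite -opprB enormN. Qed.

Lemma enorm_sqrB_le n (u v : 'cV[R]_n) :
  enorm (u - v) ^+ 2 <= 2 * enorm u ^+ 2 + 2 * enorm v ^+ 2.
Proof.
by have := dotv_ge0 (u + v); rewrite !enorm_sqr !dotvE (dotvC v u); lra.
Qed.

Lemma coord_le_enorm n (u : 'cV[R]_n) i : `|u i ord0| <= enorm u.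
Proof.
rewrite -(@ler_pXn2r _ 2) ?nnegrE ?enorm_ge0// enorm_sqr real_normK ?num_real//.
by rewrite /dotv (bigD1 i)//= -expr2 lerDl sumr_ge0// => j _; rewrite -expr2 sqr_ge0.
Qed.

(** The Frobenius norm serves as [C], by Cauchy-Schwarz on each row. This makes the set in [opnorm]
    bounded, so that its supremum is a genuine upper bound. *)
Lemma enorm_mulmx_bounded m n (A : 'M[R]_(m, n)) :
  exists2 C : R, 0 <= C & forall x, enorm (A *m x) <= C * enorm x.
Proof.
exists (Num.sqrt (\sum_i enorm (row i A)^T ^+ 2)); first exact: sqrtr_ge0.
move=> x; rewrite -(@ler_pXn2r _ 2) ?nnegrE ?mulr_ge0 ?enorm_ge0 ?sqrtr_ge0//.
rewrite enorm_sqr exprMn sqr_sqrtr; last by apply: sumr_ge0 => i _; rewrite sqr_ge0.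
rewrite mulr_suml; apply: ler_sum => i _.
have -> : (A *m x) i ord0 = dotv (row i A)^T x.
  by rewrite mxE; apply: eq_bigr => j _; rewrite !mxE.
have := dotv_le_enorm (row i A)^T x.
have := dotv_le_enorm (- (row i A)^T) x; rewrite enormN dotvNl.
by move=> h1 h2; rewrite -expr2 -exprMn; nra.
Qed.

Lemma enorm_mulmx_le_opnorm m n (A : 'M[R]_(m, n)) (x : 'cV[R]_n) :
  enorm x <= 1 -> enorm (A *m x) <= opnorm A.
Proof.
move=> x1; have [C C0 AC] := enorm_mulmx_bounded A; apply: ub_le_sup; last by exists x.
exists C => _ [u /= u1 <-]; apply: le_trans (AC u) _.
by rewrite ler_piMr.
Qed.

Lemma enorm0 n : enorm (0 : 'cV[R]_n) = 0.
Proof. by rewrite -(scale0r 0) enormZ normr0 mul0r. Qed.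

Lemma opnorm_ge0 m n (A : 'M[R]_(m, n)) : 0 <= opnorm A.
Proof.
apply: le_trans (enorm_ge0 (A *m 0)) _.
by apply: enorm_mulmx_le_opnorm; rewrite enorm0.
Qed.

Lemma enorm_mulmx_le m n (A : 'M[R]_(m, n)) (x : 'cV[R]_n) :
  enorm (A *m x) <= opnorm A * enorm x.
Proof.
have [/enorm_eq0 ->|x0] := eqVneq (enorm x) 0.
  by rewrite mulmx0 !enorm0 mulr0.
have xp : 0 < enorm x by rewrite lt0r x0 enorm_ge0.
rewrite -ler_pdivrMr// mulrC -[(enorm x)^-1]ger0_norm ?invr_ge0 ?enorm_ge0//.
rewrite -enormZ scalemxAr; apply: enorm_mulmx_le_opnorm.
by rewrite enormZ ger0_norm ?invr_ge0 ?enorm_ge0// mulVf.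
Qed.

(** Each coordinate is dominated by the Euclidean norm, so a Euclidean ball fits into the sup-norm
    ball of the same radius. *)
Lemma nbhs_enorm n (u : 'cV[R]_n) (V : set 'cV[R]_n) :
  nbhs u V -> exists2 e : R, 0 < e & forall v, enorm (v - u) < e -> V v.
Proof.
move=> /nbhs_ballP[e e0 eV]; exists e => // v vu; apply: eV.
split => // i j; rewrite ord1 /ball/= distrC; apply: le_lt_trans vu.
by have := coord_le_enorm (v - u) i; rewrite !mxE.
Qed.

Lemma compact_coord_bounded n (M : R) :
  compact [set u : 'cV[R]_n | forall i, `|u i ord0| <= M].
Proof.
have ct : continuous (trmx : 'rV[R]_n -> 'cV[R]_n).
  move=> u V /nbhs_ballP[e e0 eV]; apply/nbhs_ballP; exists e => // v [_ uv].
  by apply: eV; split => // i j; rewrite !mxE; exact: uv.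
have := @rV_compact _ n (fun=> `[(- M), M]%classic)
  (fun=> @segment_compact _ _ _).
move=> /(continuous_compact (continuous_subspaceT ct)); congr compact.
apply/seteqP; split => [_ [u uM <-] i|u uM] /=.
  by rewrite mxE ler_norml; have := uM i; rewrite /= in_itv.
by exists u^T; rewrite ?trmxK// => i /=; rewrite mxE in_itv/= -ler_norml.
Qed.

End Dot.

(** * Minimizers of strongly convex functions *)

Section Minimizers.
Context {R : realType}.

(* Strong convexity tested on real upper bounds of the values, so that no
   arithmetic with infinite values occurs. *)
Definition sconvex n (c : R) (h : 'cV[R]_n -> \bar R) : Prop :=
  forall (x y : 'cV[R]_n) (t a b : R), 0 < t < 1 -> (h x <= a%:E)%E -> (h y <= b%:E)%E ->
  (h (t *: x + (1 - t) *: y)%R <=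
    (t * a + (1 - t) * b - c / 2 * (t * (1 - t)) * enorm (x - y) ^+ 2)%:E)%E.

(** Rests on the identity [t |x|^2 + (1 - t) |y|^2 - |t x + (1 - t) y|^2 = t (1 - t) |x - y|^2]. *)
Lemma strongly_convex_sconvex n (c : R) (h : 'cV[R]_n -> \bar R) :
  strongly_convex c h -> sconvex c h.
Proof.
move=> hc x y t a b t01 xa yb; have /andP[t0 t1] := t01.
have := hc x y t t01; rewrite leeBlDr// => /le_trans; apply.
apply: (@le_trans _ _ (t%:E * (a - c / 2 * enorm x ^+ 2)%:E +
  (1 - t)%:E * (b - c / 2 * enorm y ^+ 2)%:E +
  (c / 2 * enorm (t *: x + (1 - t) *: y) ^+ 2)%:E)%E).
  rewrite leeD2r//; apply: leeD; apply: lee_wpmul2l;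
    by rewrite ?EFinB ?leeB// lee_fin ltW// subr_gt0.
rewrite -!EFinM -!EFinD lee_fin !enorm_sqr !dotvE (dotvC y x) le_eqVlt.
by apply/orP; left; apply/eqP; field.
Qed.

Lemma convex_sconvex n (h : 'cV[R]_n -> \bar R) : convex_fun h -> sconvex 0 h.
Proof.
move=> hc; apply: strongly_convex_sconvex; rewrite /strongly_convex.
by under eq_fun do rewrite !mul0r sube0.
Qed.

Lemma sconvexD_quadratic n (c c' k : R) (p : 'cV[R]_n) (h : 'cV[R]_n -> \bar R) :
  sconvex c h ->
  sconvex (c + c')
    (fun x => h x + (dotv p x + c' / 2 * enorm x ^+ 2 + k)%:E)%E.
Proof.
move=> hc x y t a b t01; rewrite -!leeBrDr// -!EFinB => xa yb.
apply: le_trans (hc _ _ _ _ _ t01 xa yb) _.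
rewrite lee_fin !enorm_sqr !dotvE (dotvC y x) le_eqVlt.
by apply/orP; left; apply/eqP; field.
Qed.

Lemma continuous_addR (T : topologicalType) (u v : T -> R) :
  continuous u -> continuous v -> continuous (fun x => u x + v x).
Proof. by move=> uc vc x; exact: (cvgD (uc x) (vc x)). Qed.

Lemma continuous_mulR (T : topologicalType) (u v : T -> R) :
  continuous u -> continuous v -> continuous (fun x => u x * v x).
Proof. by move=> uc vc x; exact: (cvgM (uc x) (vc x)). Qed.

Lemma continuous_dotv n (u v : 'cV[R]_n -> 'cV[R]_n) :
  continuous u -> continuous v -> continuous (fun x => dotv (u x) (v x)).
Proof.
have coord i (w : 'cV[R]_n -> 'cV[R]_n) :
    continuous w -> continuous (fun x => w x i ord0).
  move=> wc x; apply: (@continuous_comp _ _ _ w (fun M : 'cV[R]_n => M i ord0)).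
    exact: wc.
  exact: coord_continuous.
move=> uc vc; apply: continuous_big => [|i _]; first exact: add_continuous.
by apply: continuous_mulR; exact: coord.
Qed.

(** The new epigraph is the preimage of [epi h] under the continuous shear
    [(x, t) |-> (x, t - q x)]. *)
Lemma closed_funD_quadratic n (c' k : R) (p : 'cV[R]_n) (h : 'cV[R]_n -> \bar R) :
  closed_fun h ->
  closed_fun (fun x => h x + (dotv p x + c' / 2 * enorm x ^+ 2 + k)%:E)%E.
Proof.
move=> hc; rewrite /closed_fun.
set q : 'cV[R]_n -> R := fun x => dotv p x + c' / 2 * enorm x ^+ 2 + k.
have idc : continuous (id : 'cV[R]_n -> 'cV[R]_n) by move=> u V.
have qc : continuous q.
  apply: (@continuous_addR _ (fun x => dotv p x + c' / 2 * enorm x ^+ 2)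
    (cst k)); last exact: cst_continuous.
  apply: (@continuous_addR _ (dotv p)).
    by apply: (@continuous_dotv _ (cst p) id) => //; exact: cst_continuous.
  apply: (@continuous_mulR _ (cst (c' / 2))); first exact: cst_continuous.
  have -> : (fun y : 'cV[R]_n => enorm y ^+ 2) = (fun y => dotv y y).
    by apply/funext => y; rewrite enorm_sqr.
  exact: (@continuous_dotv _ id id).
suff -> : epi (fun x => h x + (q x)%:E)%E =
    (fun w : 'cV[R]_n * R => (w.1, w.2 - q w.1)) @^-1` epi h.
  apply: closed_comp => // w _.
  have c2 : {for w, continuous (fun w : 'cV[R]_n * R => w.2 - q w.1)}.
    apply: (@continuous_addR _ snd (fun w : 'cV[R]_n * R => - q w.1)) => u.
      exact: cvg_snd.
    apply: (@continuous_comp _ _ _ fst (fun x => - q x)); first exact: cvg_fst.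
    exact: (cvgN (qc _)).
  exact: (cvg_pair (@cvg_fst _ _ (nbhs w.1) (nbhs w.2) _) c2).
by apply/seteqP; split => -[x t]; rewrite /epi/= EFinB leeBrDr.
Qed.

Lemma closed_fun_sublevel n (h : 'cV[R]_n -> \bar R) t :
  closed_fun h -> closed [set x | (h x <= t%:E)%E].
Proof.
move=> hc; suff -> : [set x | (h x <= t%:E)%E] = (fun x => (x, t)) @^-1` epi h.
  apply: closed_comp => // x _.
  have c1 : {for x, continuous (id : 'cV[R]_n -> 'cV[R]_n)} by move=> V.
  have c2 : {for x, continuous (fun _ : 'cV[R]_n => t)} by exact: cst_continuous.
  exact: (cvg_pair c1 c2).
by [].
Qed.

(** The sublevel sets above the infimum, cut with [K], form a proper filter base; being closed, they
    all contain its cluster point. *)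
Lemma compact_closed_fun_min n (h : 'cV[R]_n -> \bar R) (K : set 'cV[R]_n) x0 :
  (forall x, h x != -oo%E) -> closed_fun h -> compact K -> K x0 ->
  exists2 p, K p & forall x, K x -> (h p <= h x)%E.
Proof.
move=> hN hc Kc Kx0; pose i := ereal_inf (h @` K).
have iK x : K x -> (i <= h x)%E by move=> Kx; apply: ereal_inf_lbound; exists x.
have [ioo|iN] := eqVneq i +oo%E.
  by exists x0 => // x /iK; rewrite ioo leye_eq => /eqP ->; rewrite leey.
pose F := filter_from [set t : R | (i < t%:E)%E]
  (fun t => [set x | K x /\ (h x <= t%:E)%E]).
have Fp : ProperFilter F.
  apply: filter_from_proper; last first.
    move=> t /= /ereal_inf_lt[_ [x Kx <-] hxt].
    by exists x; split => //; exact: ltW.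
  apply: filter_from_filter.
    have [j ij] : exists j : R, (i < j%:E)%E.
      move: iN; generalize i => -[r| |]// _; last by exists 0; exact: ltNyr.
      by exists (r + 1); rewrite lte_fin ltrDl.
    by exists j.
  move=> s t /= si ti; exists (Num.min s t); first by rewrite /= /Num.min; case: ifP.
  move=> x /= [Kx hx]; split; split=> //; apply: le_trans hx _;
    by rewrite lee_fin ge_min lexx ?orbT.
have FK : F K.
  have [t it _] : F setT by exact: filterT.
  by exists t => // x [].
have [p [Kp pF]] := Kc F Fp FK.
have pt t : (i < t%:E)%E -> (h p <= t%:E)%E.
  move=> it; have /closure_id ct := closed_fun_sublevel (t := t) hc.
  suff : [set x | (h x <= t%:E)%E] p by [].
  rewrite ct => V /pF; apply.
  by exists t => // x [].
exists p => // x /iK; apply: le_trans.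
move: iN (hN p) pt; generalize i => -[r| |]// _.
  move=> _ pt; apply/lee_addgt0Pr => e e0; rewrite -EFinD; apply: pt.
  by rewrite lte_fin ltrDl.
(* An infimum [-oo] would put [h p] below every real number, against [hN]. *)
case: (h p) => [r| |]// _ pt.
  by have := pt (r - 1) (ltNyr (r - 1)); rewrite lee_fin lerBrDr gerDl ler10.
by have := pt 0 (ltNyr 0).
Qed.

Lemma sconvex_argmin_exists n (c : R) (h : 'cV[R]_n -> \bar R) :
  0 < c -> proper_fun h -> closed_fun h -> sconvex c h -> argmin h !=set0.
Proof.
move=> c0 [hN [x0 hx0]] hc hs.
have [a0 ha0] : exists a0, h x0 = a0%:E.
  by have := hN x0; move: hx0; rewrite /edom/=; case: (h x0) => // r; exists r.
(* The minimum is taken over a compact coordinate box that contains the Euclidean ball of radius [M]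
   around [x0]. *)
have box M : 0 <= M -> exists2 p, (h p <= a0%:E)%E &
    forall x, enorm (x - x0) <= M -> (h p <= h x)%E.
  move=> M0; have inb x : enorm (x - x0) <= M ->
      forall i, `|x i ord0| <= enorm x0 + M.
    move=> xM i; apply: le_trans (coord_le_enorm x i) _.
    have := enorm_triangle x0 (x - x0); rewrite [x0 + _]addrC subrK => /le_trans.
    by apply; rewrite lerD2l.
  have x00 : enorm (x0 - x0) <= M.
    by rewrite subrr enorm0.
  have [p _ ph] := compact_closed_fun_min hN hc
    (@compact_coord_bounded R n (enorm x0 + M)) (inb _ x00).
  exists p; first by rewrite -ha0; exact/ph/inb.
  by move=> x xM; exact/ph/inb.
have [p1 p1a p1h] := box 1 ler01.
have [b hb] : exists b, h p1 = b%:E.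
  by move: p1a (hN p1); case: (h p1) => // r _ _; exists r.
have ba : b <= a0 by move: p1a; rewrite hb lee_fin.
(* Strong convexity along the ray from [x0] turns the bound on the unit ball
   into coercivity. *)
have far x : (h x <= a0%:E)%E -> enorm (x - x0) <= 1 + 2 * (a0 - b) / c.
  move=> hx; rewrite leNgt; apply/negP => xfar.
  have d0 : 0 <= 2 * (a0 - b) / c.
    by apply: divr_ge0 (ltW c0); rewrite mulr_ge0// subr_ge0.
  set r := enorm (x - x0) in xfar.
  have r1 : 1 < r by lra.
  have r0 : 0 < r by lra.
  (* With weight [1 / r] the combination lies on the unit sphere around [x0], where [h] is at least
     [b]. Hence [b <= a0 - c (r - 1) / 2], which is where the radius comes from. *)
  have t01 : 0 < r^-1 < 1 by rewrite invr_gt0 r0 invf_lt1.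
  have hx0a : (h x0 <= a0%:E)%E by rewrite ha0.
  have := hs _ _ _ _ _ t01 hx hx0a.
  have /p1h : enorm (r^-1 *: x + (1 - r^-1) *: x0 - x0) <= 1.
    have -> : r^-1 *: x + (1 - r^-1) *: x0 - x0 = r^-1 *: (x - x0).
      by rewrite scalerBl scale1r scalerBr addrA addrAC addrK.
    by rewrite enormZ ger0_norm ?invr_ge0 ?(ltW r0)// mulVf// gt_eqF.
  move=> /le_trans/[apply]; rewrite hb lee_fin -/r.
  have -> : r^-1 * a0 + (1 - r^-1) * a0 - c / 2 * (r^-1 * (1 - r^-1)) * r ^+ 2 =
    a0 - c / 2 * (r - 1) by field; rewrite gt_eqF.
  have : 2 * (a0 - b) / c < r - 1 by lra.
  by rewrite ltr_pdivrMr//; nra.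
have [|p pa ph] := box (1 + 2 * (a0 - b) / c).
  by apply: addr_ge0 => //; apply: divr_ge0 (ltW c0); rewrite mulr_ge0// subr_ge0.
exists p => x; have [/far/ph//|/ltW] := leP (h x) a0%:E.
exact: le_trans.
Qed.

(** Comparing [p] with [t x + (1 - t) p] gives [(1 - t) Q <= b - a], where [Q] is the quadratic
    term; a suitable small [t] replaces the limit [t -> 0]. *)
Lemma argmin_growth n (c : R) (h : 'cV[R]_n -> \bar R) p x a b :
  sconvex c h -> argmin h p -> h p = a%:E -> (h x <= b%:E)%E ->
  a + c / 2 * enorm (x - p) ^+ 2 <= b.
Proof.
move=> hs pmin hp hx; rewrite leNgt; apply/negP => lt_b.
have ab : a <= b by rewrite -lee_fin -hp; apply: le_trans hx; exact: pmin.
set Q := c / 2 * enorm (x - p) ^+ 2 in lt_b.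
have Q0 : 0 < Q by lra.
(* Half of the threshold [1 - (b - a) / Q] below which [(1 - t) Q <= b - a] fails. *)
pose t := (Q - (b - a)) / (2 * Q).
have tQ : t * (2 * Q) = Q - (b - a) by rewrite /t divfK// mulf_neq0// gt_eqF.
have t01 : 0 < t < 1 by apply/andP; split; nra.
have hpa : (h p <= a%:E)%E by rewrite hp.
have := hs _ _ _ _ _ t01 hx hpa.
move=> /(le_trans (pmin _)); rewrite hp lee_fin.
have -> : c / 2 * (t * (1 - t)) * enorm (x - p) ^+ 2 = t * (1 - t) * Q.
  by rewrite /Q; ring.
by case/andP: t01 => t0 t1; nra.
Qed.

End Minimizers.

(** * Dual function and envelope *)

Section DualFunction.
Context {R : realType} {n m : nat} (A : 'M[R]_(m, n)).
Context (f : 'cV[R]_n -> \bar R) (g : 'cV[R]_m -> \bar R).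
Hypothesis f_proper : proper_fun f.
Hypothesis g_proper : proper_fun g.

Lemma proper_fun_finite k (h : 'cV[R]_k -> \bar R) :
  proper_fun h -> exists x p, h x = p%:E.
Proof.
move=> [hN [x]]; rewrite /edom/= => hx; exists x.
by move: hx (hN x); case: (h x) => // p; exists p.
Qed.

(** The dual function is the supremum of the affine functions [u |-> <u, z - A x> - f x - g z].
    Quantifying over finite values only keeps infinite arithmetic out of all later estimates. *)
Lemma dual_fun_le u a :
  (dual_fun f g A u <= a%:E)%E <->
  forall x z p q, f x = p%:E -> g z = q%:E -> dotv u (z - A *m x) - p - q <= a.
Proof.
rewrite /dual_fun; set F := conjugate f _; set G := conjugate g _.
have Fge x p : f x = p%:E -> ((- dotv u (A *m x) - p)%:E <= F)%E.
  move=> fx; apply: ereal_sup_ubound; exists x => //.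
  by rewrite fx dotvNl dotv_trmx -EFinB.
have Gge z q : g z = q%:E -> ((dotv u z - q)%:E <= G)%E.
  by move=> gz; apply: ereal_sup_ubound; exists z => //; rewrite gz -EFinB.
have Fle b : (forall x p, f x = p%:E -> - dotv u (A *m x) - p <= b) -> (F <= b%:E)%E.
  move=> H; apply: ge_ereal_sup => _ [x _ <-].
  case: f_proper => fN _; move: (fN x) (H x); case: (f x) => [p| |]//= _.
    by move=> /(_ p erefl); rewrite dotvNl dotv_trmx -EFinB lee_fin.
  by rewrite leNye.
have Gle b : (forall z q, g z = q%:E -> dotv u z - q <= b) -> (G <= b%:E)%E.
  move=> H; apply: ge_ereal_sup => _ [z _ <-].
  case: g_proper => gN _; move: (gN z) (H z); case: (g z) => [q| |]//= _.
    by move=> /(_ q erefl); rewrite -EFinB lee_fin.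
  by rewrite leNye.
split=> [FG x z p q fx gz|H].
  have := le_trans (leeD (Fge _ _ fx) (Gge _ _ gz)) FG.
  by rewrite -EFinD lee_fin !dotvE; lra.
have [x0 [p0 fx0]] := proper_fun_finite f_proper.
have [z0 [q0 gz0]] := proper_fun_finite g_proper.
have GF x p : f x = p%:E -> (G <= (a - (- dotv u (A *m x) - p))%:E)%E.
  move=> fx; apply: Gle => z q gz.
  by have := H _ _ _ _ fx gz; rewrite !dotvE; lra.
(* One point of each domain bounds [G] from both sides; once [G] is real, it can be moved to the
   other side of the inequality. *)
have G0 := GF _ _ fx0; move: (Gge _ _ gz0) G0 GF.
case: (G) => [r| |]// _ _ GF.
rewrite -leeBrDr// -EFinB; apply: Fle => x p /GF.
by rewrite lee_fin; lra.
Qed.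

Lemma dual_fun_sconvex : sconvex 0 (dual_fun f g A).
Proof.
move=> u v t a b /andP[t0 t1] /dual_fun_le ua /dual_fun_le vb.
apply/dual_fun_le => x z p q fx gz.
have := ua _ _ _ _ fx gz; have := vb _ _ _ _ fx gz.
rewrite dotvDl !dotvZl; set U := dotv u _; set V := dotv v _; nra.
Qed.

(* Convexity propagates the local quadratic growth along rays, hence the linear
   growth outside of the ball. *)
Lemma dual_fun_growth ys ps :
  strong_minimizer (dual_fun f g A) ys -> dual_fun f g A ys = ps%:E ->
  exists e al : R, [/\ 0 < e, 0 < al &
    forall y b, (dual_fun f g A y <= b%:E)%E ->
      (enorm (y - ys) <= e -> al * enorm (y - ys) ^+ 2 <= b - ps) /\
      (e <= enorm (y - ys) -> al * e * enorm (y - ys) <= b - ps)].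
Proof.
move=> [_ [al al0 /nbhs_enorm[e e0 He]]] hps.
have near y b : (dual_fun f g A y <= b%:E)%E -> enorm (y - ys) <= e / 2 ->
    al * enorm (y - ys) ^+ 2 <= b - ps.
  move=> yb ye; have ye' : enorm (y - ys) < e by lra.
  have := He _ ye'; rewrite hps -lee_fin => /le_trans; apply.
  by rewrite EFinB leeB.
(* Halving turns the open ball of the strong minimizer into a closed one, so that both regimes
   include the boundary. *)
exists (e / 2), al; split => //; first by rewrite divr_gt0.
move=> y b yb; split; first exact: near.
move=> ye; set r := enorm (y - ys) in ye *.
have e20 : 0 < e / 2 by rewrite divr_gt0.
have r0 : 0 < r by lra.
have [re|re] := leP r (e / 2).
  have <- : r = e / 2 by lra.
  by have := near _ _ yb re; rewrite -/r; lra.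
(* The weight that puts the combination of [y] and [ys] at distance exactly [e / 2] from [ys]. *)
pose t := e / 2 / r.
have tr : t * r = e / 2 by rewrite /t divfK// gt_eqF.
have t01 : 0 < t < 1 by rewrite divr_gt0//= ltr_pdivrMr// mul1r.
have ysps : (dual_fun f g A ys <= ps%:E)%E by rewrite hps.
have := dual_fun_sconvex t01 yb ysps.
move=> /near; have -> : t *: y + (1 - t) *: ys - ys = t *: (y - ys).
  by rewrite scalerBl scale1r scalerBr addrA addrAC addrK.
have /andP[t0 _] := t01.
rewrite enormZ ger0_norm ?(ltW t0)// -/r tr lexx mul0r !mul0r subr0 => /(_ isT) h.
by rewrite -(ler_pM2l t0); nra.
Qed.

End DualFunction.

(** * Optimality of the primal updates and inequalities for the envelope *)

Section PrimalUpdate.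
Context {R : realType} {n m : nat} (A : 'M[R]_(m, n)).
Context (f : 'cV[R]_n -> \bar R) (g : 'cV[R]_m -> \bar R) (mu gamma : R).
Hypothesis mu_gt0 : 0 < mu.
Hypothesis f_proper : proper_fun f.
Hypothesis f_closed : closed_fun f.
Hypothesis f_sconvex : sconvex mu f.
Hypothesis g_proper : proper_fun g.
Hypothesis g_closed : closed_fun g.
Hypothesis g_sconvex : sconvex 0 g.
Hypothesis gamma_gt0 : 0 < gamma.
Hypothesis gamma_lt : gamma * opnorm A ^+ 2 < mu.

(** The vanishing terms give the objective of the [x]-update the shape of the lemmas on quadratic
    perturbations; [pg] does the same for the [z]-update, with modulus [gamma]. *)
Let pf y x := (f x + (dotv (A^T *m y) x + 0 / 2 * enorm x ^+ 2 + 0)%:E)%E.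

Let pg k v z := (g z + (dotv v z + gamma / 2 * enorm z ^+ 2 + k)%:E)%E.

Lemma lagrangian_quadratic y :
  (fun x' => f x' + (dotv y (A *m x'))%:E)%E = pf y.
Proof.
by apply/funext => x; rewrite /pf dotv_trmx mul0r mul0r !addr0.
Qed.

Lemma auglag_quadratic y x p : f x = p%:E ->
  (fun z' => auglag f g A gamma x z' y) =
  pg (p + dotv y (A *m x) + gamma / 2 * enorm (A *m x) ^+ 2)
     (- (y + gamma *: (A *m x))).
Proof.
move=> fx; apply/funext => z; rewrite /auglag /pg fx (addeC p%:E) -!addeA -!EFinD.
congr (_ + _%:E)%E; rewrite !enorm_sqr !dotvE (dotvC z (A *m x)).
  by field.
Qed.

Lemma properD k (h : 'cV[R]_k -> \bar R) (q : 'cV[R]_k -> R) :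
  proper_fun h -> proper_fun (fun x => h x + (q x)%:E)%E.
Proof.
move=> [hN [x hx]]; split.
  by move=> z; move: (hN z); case: (h z).
by exists x; move: hx (hN x); rewrite /edom/=; case: (h x) => // r _ _; rewrite -EFinD ltry.
Qed.

Lemma argmin_finite k (h : 'cV[R]_k -> \bar R) (q : 'cV[R]_k -> R) x :
  proper_fun h -> argmin (fun x => h x + (q x)%:E)%E x -> exists p, h x = p%:E.
Proof.
move=> hp xmin; have [x0 [p0 hx0]] := proper_fun_finite hp.
case: hp => hN _; have := xmin x0; move: (hN x); rewrite hx0 -EFinD.
by case: (h x) => // r _ _; exists r.
Qed.

Lemma primal_update_exists y : exists x z, primal_update f g A gamma y x z.
Proof.
have mu0 : 0 < mu + 0 by rewrite addr0.
have ga0 : 0 < 0 + gamma by rewrite add0r.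
have [x xmin] := sconvex_argmin_exists mu0 (properD _ f_proper)
  (@closed_funD_quadratic _ _ 0 0 (A^T *m y) _ f_closed)
  (@sconvexD_quadratic _ _ _ 0 0 (A^T *m y) _ f_sconvex).
have [p fx] := argmin_finite f_proper xmin.
pose v := - (y + gamma *: (A *m x)).
pose k := p + dotv y (A *m x) + gamma / 2 * enorm (A *m x) ^+ 2.
have [z zmin] := sconvex_argmin_exists ga0 (properD _ g_proper)
  (@closed_funD_quadratic _ _ gamma k v _ g_closed)
  (@sconvexD_quadratic _ _ _ gamma k v _ g_sconvex).
by exists x, z; split; rewrite ?lagrangian_quadratic ?(auglag_quadratic _ fx).
Qed.

(** Both conditions come from [argmin_growth]. For [z] the growth term cancels against the penalty,
    which leaves [y + gamma (A x - z)] as a subgradient of [g] at [z]. *)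
Lemma primal_update_optimality y x z : primal_update f g A gamma y x z ->
  exists p q, [/\ f x = p%:E, g z = q%:E,
    forall x' p', f x' = p'%:E ->
      p + dotv y (A *m x) + mu / 2 * enorm (x' - x) ^+ 2 <= p' + dotv y (A *m x') &
    forall z' q', g z' = q'%:E ->
      q + dotv (y + gamma *: (A *m x - z)) (z' - z) <= q'].
Proof.
move=> [xmin]; move: (xmin); rewrite lagrangian_quadratic => xmin'.
have [p fx] := argmin_finite f_proper xmin.
rewrite (auglag_quadratic _ fx) => zmin.
have [q gz] := argmin_finite g_proper zmin.
exists p, q; split => //.
  move=> x' p' fx'.
  have h1 : pf y x = (p + dotv y (A *m x))%:E.
    by rewrite -lagrangian_quadratic fx.
  have h2 : (pf y x' <= (p' + dotv y (A *m x'))%:E)%E.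
    by rewrite -lagrangian_quadratic fx'.
  have := argmin_growth (@sconvexD_quadratic _ _ _ 0 0 (A^T *m y) _ f_sconvex) xmin' h1 h2.
  by rewrite addr0.
move=> z' q' gz'.
set k := p + _ + _ in zmin; set v := - _ in zmin.
have h1 : pg k v z = (q + (dotv v z + gamma / 2 * enorm z ^+ 2 + k))%:E.
  by rewrite /pg gz.
have h2 : (pg k v z' <= (q' + (dotv v z' + gamma / 2 * enorm z' ^+ 2 + k))%:E)%E.
  by rewrite /pg gz'.
have := argmin_growth (@sconvexD_quadratic _ _ _ gamma k v _ g_sconvex) zmin h1 h2.
by rewrite /v !enorm_sqr !dotvE (dotvC z z'); lra.
Qed.

(* The alternating minimization envelope, i.e. the forward-backward envelope of
   the dual function. *)
Definition envelope y x z : R := - fine (auglag f g A gamma x z y).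

Lemma envelopeE y x z p q : f x = p%:E -> g z = q%:E ->
  envelope y x z =
  - (p + q + dotv y (A *m x - z) + gamma / 2 * enorm (A *m x - z) ^+ 2).
Proof. by move=> fx gz; rewrite /envelope /auglag fx gz. Qed.

Lemma auglag_envelope y x z : primal_update f g A gamma y x z ->
  auglag f g A gamma x z y = (- envelope y x z)%:E.
Proof.
move=> /primal_update_optimality[p [q [fx gz _ _]]].
by rewrite (envelopeE _ fx gz) opprK /auglag fx gz.
Qed.

(** Fenchel's inequality at [u] for the pair [(x, z)], then Young's inequality for [<u - y, s>],
    whose [gamma / 2 |s|^2] is paid by the penalty term. *)
Lemma envelope_le y x z u a : primal_update f g A gamma y x z ->
  (dual_fun f g A u <= a%:E)%E ->
  envelope y x z <= a + enorm (u - y) ^+ 2 / (2 * gamma).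
Proof.
move=> /primal_update_optimality[p [q [fx gz _ _]]].
move=> /(dual_fun_le A f_proper g_proper)/(_ _ _ _ _ fx gz) ua.
rewrite (envelopeE _ fx gz).
have zs : z - A *m x = - (A *m x - z) by rewrite opprB.
rewrite zs -{1}(subrK y u) in ua.
move: ua; move: (A *m x - z) (u - y) => s d ua.
have := dotv_ge0 (d - gamma *: s).
rewrite !dotvE -!enorm_sqr (dotvC s d) => h; rewrite !dotvE in ua.
set D := enorm d ^+ 2 in h *; set S := enorm s ^+ 2 in h *.
rewrite -lerBlDl ler_pdivlMr ?mulr_gt0//.
by have := ler_wpM2l (ltW gamma_gt0) ua; lra.
Qed.

(** The new multiplier is a subgradient of [g] at [z], so the [g] part costs nothing. In the [f]
    part the multiplier moves by [gamma s], and the strong convexity of [f] absorbs this up to the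
    last term. *)
Lemma dual_fun_update_le y x z p q :
  primal_update f g A gamma y x z -> f x = p%:E -> g z = q%:E ->
  (dual_fun f g A (y + gamma *: (A *m x - z)) <=
    (- p - q - dotv (y + gamma *: (A *m x - z)) (A *m x - z)
      + gamma ^+ 2 * opnorm A ^+ 2 / (2 * mu) * enorm (A *m x - z) ^+ 2)%:E)%E.
Proof.
move=> /primal_update_optimality[p1 [q1 [-> -> Hf Hg]]] [<-] [<-].
set s := A *m x - z.
apply/(dual_fun_le A f_proper g_proper) => x' z' p' q' fx' gz'.
have := Hf _ _ fx'; have := Hg _ _ gz'; rewrite -/s.
have := dotv_le_enorm (- s) (A *m (x' - x)); rewrite enormN.
have := enorm_mulmx_le A (x' - x).
have := enorm_ge0 s; have := enorm_ge0 (x' - x).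
have zE : z = A *m x - s by rewrite /s opprB addrC subrK.
clearbody s; subst z.
rewrite mulmxBr !dotvE -enorm_sqr.
set E := enorm (x' - x); set S := enorm s; set K := opnorm A.
move=> E0 S0 AE sAE h1 h2.
have sAE2 : - (dotv s (A *m x') - dotv s (A *m x)) <= S * (K * E).
  by have := ler_wpM2l S0 AE; lra.
(* The right-hand side is the maximum of the left-hand side over [E]. *)
have amgm : gamma * (S * (K * E)) - mu / 2 * E ^+ 2 <=
    gamma ^+ 2 * K ^+ 2 / (2 * mu) * S ^+ 2.
  rewrite [leRHS]mulrAC ler_pdivlMr ?mulr_gt0//.
  by have := sqr_ge0 (gamma * K * S - mu * E); nra.
have := ler_wpM2l (ltW gamma_gt0) sAE2.
lra.
Qed.

Let c := gamma / 2 * (1 - gamma * opnorm A ^+ 2 / mu).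

(** Moving by [gamma s] lowers the bound by [gamma |s|^2], half of which the penalty in the envelope
    already accounts for; [c] is the other half minus the loss in [dual_fun_update_le]. *)
Lemma envelope_decrease y x z : primal_update f g A gamma y x z ->
  (dual_fun f g A (y + gamma *: (A *m x - z)) <= (envelope y x z - c * enorm (A *m x - z) ^+ 2)%:E)%E.
Proof.
move=> yxz; have [p [q [fx gz _ _]]] := primal_update_optimality yxz.
apply: le_trans (dual_fun_update_le yxz fx gz) _; rewrite lee_fin.
rewrite (envelopeE _ fx gz) dotvDl dotvZl -enorm_sqr /c le_eqVlt.
by apply/orP; left; apply/eqP; field; rewrite gt_eqF.
Qed.

Lemma decrease_gt0 : 0 < c.
Proof.
by rewrite /c mulr_gt0 ?divr_gt0// subr_gt0 ltr_pdivrMr// mul1r.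
Qed.

(** In effect [- s] is an approximate subgradient of the dual function at the updated multiplier,
    with error at most [gamma / 2 |s|^2]. With [u = ys], small residuals thus force small dual
    gaps. *)
Lemma dual_fun_gap y x z u a : primal_update f g A gamma y x z ->
  (dual_fun f g A u <= a%:E)%E ->
  (dual_fun f g A (y + gamma *: (A *m x - z)) <=
    (a + enorm (y + gamma *: (A *m x - z) - u) * enorm (A *m x - z) + gamma / 2 * enorm (A *m x - z) ^+ 2)%:E)%E.
Proof.
move=> yxz ua; have [p [q [fx gz _ _]]] := primal_update_optimality yxz.
apply: le_trans (dual_fun_update_le yxz fx gz) _; rewrite lee_fin.
set s := A *m x - z.
move: ua => /(dual_fun_le A f_proper g_proper)/(_ _ _ _ _ fx gz).
have -> : z - A *m x = - s by rewrite opprB.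
rewrite dotvNr; move: (y + gamma *: s) => w ua; clearbody s.
have := dotv_le_enorm (- (w - u)) s; rewrite enormN !dotvE => h.
have := decrease_gt0; rewrite /c => c0.
have := mulr_ge0 (ltW c0) (sqr_ge0 (enorm s)).
have -> : gamma ^+ 2 * opnorm A ^+ 2 / (2 * mu) =
  gamma / 2 - gamma / 2 * (1 - gamma * opnorm A ^+ 2 / mu).
  by field; rewrite gt_eqF.
move: h ua; set W := enorm (w - u) * enorm s; set S := enorm s ^+ 2.
set C := gamma / 2 * (1 - _).
lra.
Qed.

(** Adding the growth inequalities at [x] and at [x'] gives
    [mu |x - x'|^2 <= <y - y', A (x' - x)>]. *)
Lemma primal_update_lipschitz y x z y' x' z' :
  primal_update f g A gamma y x z -> primal_update f g A gamma y' x' z' ->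
  enorm (x - x') <= opnorm A / mu * enorm (y - y').
Proof.
move=> /primal_update_optimality[p [q [fx _ H _]]].
move=> /primal_update_optimality[p' [q' [fx' _ H' _]]].
have := H _ _ fx'; have := H' _ _ fx.
rewrite -[x' - x]opprB enormN.
have := dotv_le_enorm (- (y - y')) (A *m (x - x')); rewrite enormN.
have := enorm_mulmx_le A (x - x'); rewrite mulmxBr !dotvE.
have := enorm_ge0 (y - y'); have := enorm_ge0 (x - x').
set X := enorm (x - x'); set Y := enorm (y - y'); set K := opnorm A.
move=> X0 Y0 AX h1 h2 h3.
have := ler_wpM2l Y0 AX => h4.
have h5 : mu * X ^+ 2 <= K * Y * X by nra.
rewrite mulrAC ler_pdivlMr//.
have [->|Xn] := eqVneq X 0.
  by rewrite mul0r mulr_ge0// opnorm_ge0.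
have Xp : 0 < X by rewrite lt0r Xn.
by rewrite -(ler_pM2r Xp); lra.
Qed.

(** Needed because [accepted] names minimizers of its own at the trial point. The Lipschitz bound
    identifies the [x] parts, and both [z] parts attain the same minimum. *)
Lemma envelope_unique y x z x' z' :
  primal_update f g A gamma y x z -> primal_update f g A gamma y x' z' ->
  envelope y x z = envelope y x' z'.
Proof.
move=> yxz yxz'.
have xx' : x = x'.
  have := primal_update_lipschitz yxz yxz'.
  rewrite subrr enorm0 mulr0 => xx; apply/eqP; rewrite -subr_eq0; apply/eqP.
  by apply: enorm_eq0; apply/eqP; rewrite eq_le xx enorm_ge0.
move: yxz yxz'; rewrite -xx' => -[_ zmin] [_ zmin'].
congr (- fine _); apply/le_anti/andP; split; first exact: zmin.
exact: zmin'.
Qed.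

(** At [ys] the two envelope inequalities give [ps <= ps - c |s|^2], so the residual vanishes. Then
    the multiplier terms of the two optimality conditions cancel in their sum, which leaves primal
    optimality. *)
Lemma primal_update_at_min ys ps x z :
  dual_fun f g A ys = ps%:E -> (forall y, (ps%:E <= dual_fun f g A y)%E) ->
  primal_update f g A gamma ys x z ->
  A *m x = z /\ argmin (fun x => f x + g (A *m x))%E x.
Proof.
move=> hps pmin yxz.
have ysps : (dual_fun f g A ys <= ps%:E)%E by rewrite hps.
have h1 := envelope_le yxz ysps.
have := le_trans (pmin _) (envelope_decrease yxz); rewrite lee_fin => h2.
have s0 : A *m x - z = 0.
  apply: enorm_eq0; apply/eqP; rewrite -sqrf_eq0 eq_le sqr_ge0 andbT.
  rewrite subrr enorm0 expr0n mul0r addr0 in h1.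
  by rewrite -(pmulr_rle0 _ decrease_gt0); lra.
have /eqP := s0; rewrite subr_eq0 => /eqP Axz; split => // x' /=.
have [p [q [fx gz Hf Hg]]] := primal_update_optimality yxz.
rewrite Axz fx gz.
case: f_proper (g_proper) => fN _ [gN _].
move: (fN x') (gN (A *m x')) (Hf x') (Hg (A *m x')).
case: (f x') => [p'| |]//; case: (g (A *m x')) => [q'| |]// _ _.
  move=> /(_ p' erefl) hp /(_ q' erefl); rewrite s0 scaler0 addr0 -Axz.
  rewrite -!EFinD lee_fin !dotvE => hq.
  by have := mulr_ge0 (ltW mu_gt0) (sqr_ge0 (enorm (x' - x))); lra.
all: by rewrite ?addye ?addey ?leey.
Qed.

End PrimalUpdate.

(** * Descent sequences *)

Section RealSequences.
Context {R : realType}.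

Lemma cvg_sqr0 (u : nat -> R) : u k ^+ 2 @[k --> \oo] --> 0 -> u k @[k --> \oo] --> 0.
Proof.
move=> /cvgr0Pnorm_lt h; apply/cvgr0Pnorm_lt => e e0.
have := h _ (exprn_gt0 2 e0); apply: filterS => k.
by rewrite normrX ltr_pXn2r ?nnegrE ?(ltW e0).
Qed.

Lemma cvg_le0 (u v : nat -> R) : (\forall k \near \oo, 0 <= u k <= v k) ->
  v k @[k --> \oo] --> 0 -> u k @[k --> \oo] --> 0.
Proof. by move=> uv v0; exact: (squeeze_cvgr (f := cst 0) uv (cvg_cst 0) v0). Qed.

Lemma near_inftyS (Q : nat -> Prop) :
  (\forall k \near \oo, Q k) -> \forall k \near \oo, Q k.+1.
Proof. by move=> [N _ NQ]; exists N => // k /= Nk; apply: NQ => /=; exact: leqW. Qed.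

(** Here [P] is the envelope gap at [y k], [E] the dual gap at [y k.+1], [D] the distance to [ys]
    and [r] the trial residual. Monotonicity of [P] gives [r --> 0], boundedness of [D] then gives
    [E --> 0], and growth gives [D --> 0]. *)
Lemma descent_cvg (P E D r : nat -> R) (c e al G : R) :
  0 < c -> 0 < e -> 0 < al -> 0 <= G ->
  (forall k, 0 <= P k) -> (forall k, 0 <= D k) -> (forall k, 0 <= r k) ->
  (forall k, P k.+1 <= E k) -> (forall k, E k + c * r k ^+ 2 <= P k) ->
  (forall k, E k <= D k.+1 * r k + G * r k ^+ 2) ->
  (forall k, D k.+1 <= e -> al * D k.+1 ^+ 2 <= E k) ->
  (forall k, e <= D k.+1 -> al * e * D k.+1 <= E k) ->
  D k @[k --> \oo] --> 0.
Proof.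
move=> c0 e0 al0 G0 P0 D0 r0 PE EP Er Dle Dge.
have cr0 k : 0 <= c * r k ^+ 2 by rewrite mulr_ge0 ?sqr_ge0 ?(ltW c0).
have Pdec k : P k.+1 <= P k.
  by apply: le_trans (PE k) _; apply: le_trans (EP k); rewrite lerDl.
have Pni : nonincreasing_seq P by apply/nonincreasing_seqP.
have PP0 k : P k <= P 0 by exact: Pni.
have Pcvg : cvgn P.
  by apply: nonincreasing_is_cvgn => //; exists 0 => _ [k _ <-].
have dP : P k - P k.+1 @[k --> \oo] --> 0.
  rewrite -(subrr (limn P)); apply: cvgB => //.
  by rewrite (cvg_shiftS P).
have rc : r k @[k --> \oo] --> 0.
  apply: cvg_sqr0; apply: (@cvg_le0 _ (fun k => c^-1 * (P k - P k.+1))).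
    apply: nearW => k; rewrite sqr_ge0/= -(ler_pM2l c0) mulVKf ?gt_eqF//.
    by have := PE k; have := EP k; lra.
  by rewrite -(mulr0 c^-1); apply: cvgM => //; exact: cvg_cst.
(* Either [D k.+1 <= e], or linear growth together with [E k <= P 0] bounds it. *)
pose M := e + (al * e)^-1 * P 0.
have ae0 : 0 < al * e by rewrite mulr_gt0.
have DM k : D k.+1 <= M.
  have MP : 0 <= (al * e)^-1 * P 0 by rewrite mulr_ge0// invr_ge0 ltW.
  have [De|/ltW De] := leP (D k.+1) e; first by rewrite /M; lra.
  suff : D k.+1 <= (al * e)^-1 * P 0 by rewrite /M; lra.
  rewrite -(ler_pM2l ae0) mulVKf ?gt_eqF//.
  apply: le_trans (Dge _ De) _; apply: le_trans (PP0 k).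
  by apply: le_trans (EP k); rewrite lerDl.
have E0 k : 0 <= E k by exact: le_trans (P0 k.+1) (PE k).
have Ec : E k @[k --> \oo] --> 0.
  apply: (@cvg_le0 _ (fun k => M * r k + G * (r k * r k))).
    apply: nearW => k; rewrite E0/=; apply: le_trans (Er k) _.
    by rewrite -expr2 lerD2r ler_wpM2r.
  have : M * r k + G * (r k * r k) @[k --> \oo] --> M * 0 + G * (0 * 0).
    by apply: cvgD; apply: cvgM; [exact: cvg_cst|exact: rc|exact: cvg_cst|apply: cvgM].
  by rewrite !mulr0 addr0.
suff : D k.+1 @[k --> \oo] --> 0 by rewrite (cvg_shiftS D).
apply: cvg_sqr0; apply: (@cvg_le0 _ (fun k => al^-1 * E k)); last first.
  by rewrite -(mulr0 al^-1); apply: cvgM => //; exact: cvg_cst.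
have ae20 : 0 < al * e * e by rewrite mulr_gt0.
(* Below this threshold the linear regime is impossible, so quadratic growth applies. *)
have En : \forall k \near \oo, E k < al * e * e by exact: cvgr_lt Ec _ ae20.
apply: filterS En => k Ek.
rewrite sqr_ge0/= -(ler_pM2l al0) mulVKf ?gt_eqF//.
have [De|De] := leP (D k.+1) e; first exact: Dle.
by have := Dge _ (ltW De); have := ltr_pM2l ae0 e (D k.+1); rewrite De; lra.
Qed.

End RealSequences.

(** * Superlinear convergence *)

Theorem mainTheorem8 (R : realType) (n m : nat) (A : 'M[R]_(m, n))
  (f : 'cV[R]_n -> \bar R) (g : 'cV[R]_m -> \bar R) (mu : R)
  (mu_gt0 : 0 < mu)
  (f_proper : proper_fun f) (f_closed : closed_fun f)
  (f_strong : strongly_convex mu f)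
  (g_proper : proper_fun g) (g_closed : closed_fun g) (g_convex : convex_fun g)
  (dom_meet : [set A *m x | x in edom f] `&` edom g !=set0)
  (xs : 'cV[R]_n)
  (xs_min : argmin (fun x => f x + g (A *m x))%E = [set xs])
  (ys : 'cV[R]_m)
  (ys_min : strong_minimizer (dual_fun f g A) ys)
  (* (a) *)
  (f_strict : \forall x \near xs, edom f x -> strictly_twice_epi_diff f x)
  (Sf : {vspace 'cV[R]_n}) (Hf : 'M[R]_n)
  (f_epi : second_epi_derivative f xs (- (A^T *m ys)) (quad_ind Hf Sf))
  (Hf_psd : psd Hf)
  (Hf_range : range (fun w : 'cV[R]_n => Hf *m w) = [set w | w \in Sf])
  (Hf_ker : [set w : 'cV[R]_n | Hf *m w = 0] = orthogonal_set Sf)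
  (* (b) *)
  (Sg : {vspace 'cV[R]_m}) (Hg : 'M[R]_m)
  (g_epi : second_epi_derivative g (A *m xs) ys (quad_ind Hg Sg))
  (Hg_psd : psd Hg)
  (Hg_range : range (fun w : 'cV[R]_m => Hg *m w) `<=` [set w | w \in Sg])
  (Hg_ker : orthogonal_set Sg `<=` [set w : 'cV[R]_m | Hg *m w = 0])
  (* gamma < mu / |A|^2, the right-hand side being infinite when A = 0 *)
  (gamma beta : R)
  (gamma_gt0 : 0 < gamma) (gamma_lt : gamma * opnorm A ^+ 2 < mu)
  (beta_gt0 : 0 < beta) (beta_lt1 : beta < 1)
  (x : nat -> 'cV[R]_n) (z y d : nat -> 'cV[R]_m) (tau : nat -> R)
  (xt : nat -> 'cV[R]_n) (zt yt : nat -> 'cV[R]_m)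
  (xy_nama : nama f g A gamma beta x z y d tau xt zt yt)
  (not_stopped : forall k, A *m x k <> z k)
  (d_superlinear :
     enorm (y k + d k - ys) / enorm (y k - ys) @[k --> \oo] --> 0) :
  [/\ \forall k \near \oo, tau k = 1,
      (\forall k \near \oo, (dual_fun f g A (y k)
          - ereal_inf (range (dual_fun f g A)))%E \is a fin_num)
      /\ Qsuperlinear (fun k => fine (dual_fun f g A (y k)
          - ereal_inf (range (dual_fun f g A)))%E),
      Qsuperlinear (fun k => enorm (y k - ys))
    & Rsuperlinear (fun k => enorm (x k - xs))].
Proof.
have fs := strongly_convex_sconvex f_strong.
have gs := convex_sconvex g_convex.
set psi := dual_fun f g A in ys_min *.
have [ps hps] : exists ps, psi ys = ps%:E.
  by exists (fine (psi ys)); rewrite fineK//; case: ys_min.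
have ysps : (psi ys <= ps%:E)%E by rewrite hps.
have [e [al [e0 al0 grow]]] := dual_fun_growth f_proper g_proper ys_min hps.
(* Growth makes the local minimizer global, since its lower bound is nonnegative in both regimes. *)
have pb u b : (psi u <= b%:E)%E -> ps <= b.
  move=> /grow[h1 h2]; rewrite -subr_ge0.
  have [/h1|/ltW /h2] := leP (enorm (u - ys)) e; apply: le_trans.
    by rewrite mulr_ge0 ?sqr_ge0 ?(ltW al0).
  by rewrite !mulr_ge0 ?enorm_ge0 ?(ltW al0) ?(ltW e0).
have pmin u : (ps%:E <= psi u)%E.
  case E : (psi u) => [b| |]; last 2 first.
  - exact: leey.
  - by have := pb u (ps - 1); rewrite E => /(_ (leNye _)); rewrite lerBrDr gerDl ler10.
  by rewrite lee_fin; apply: (pb u); rewrite E.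
have psinf : ereal_inf (range psi) = ps%:E.
  apply/le_anti/andP; split; first by apply: ereal_inf_lbound; exists ys.
  by apply: le_ereal_inf_tmp => _ [u _ <-].
(* The primal update at [ys] is [xs], so the Lipschitz bound will compare [x k] with [xs]. *)
have [x0 [z0 U0]] := primal_update_exists A mu_gt0 f_proper f_closed fs g_proper g_closed gs gamma_gt0 ys.
have at_min := primal_update_at_min mu_gt0 f_proper fs g_proper gs gamma_gt0 gamma_lt hps pmin.
have x0xs : x0 = xs by have [_] := at_min _ _ U0; rewrite xs_min.
case: xy_nama => Uk tau_pow tau_acc tau_max ytE Ut yS.
pose D k := enorm (y k - ys).
pose r k := enorm (A *m xt k - zt k).
pose env := envelope A f g gamma.
pose P k := env (y k) (x k) (z k) - ps.
(* The index is shifted because [psi] may be infinite at [y 0], whereas [envelope_decrease] makes it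
   finite at every later iterate. *)
pose E k := fine (psi (y k.+1)) - ps.
pose c := gamma / 2 * (1 - gamma * opnorm A ^+ 2 / mu).
have c0 : 0 < c := decrease_gt0 mu_gt0 gamma_gt0 gamma_lt.
have decr := envelope_decrease mu_gt0 f_proper fs g_proper gs gamma_gt0.
have gap := dual_fun_gap mu_gt0 f_proper fs g_proper gs gamma_gt0 gamma_lt.
have env_le := envelope_le f_proper fs g_proper gs gamma_gt0.
have D_gt0 k : 0 < D k.
  rewrite lt0r enorm_ge0 andbT; apply/eqP => /enorm_eq0/eqP.
  rewrite subr_eq0 => /eqP yys; apply: (not_stopped k).
  by have := Uk k; rewrite yys => /at_min[].
have hE k : psi (y k.+1) = (E k + ps)%:E.
  rewrite /E subrK fineK// yS; have := decr _ _ _ _ (Ut k).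
  by have := pmin (yt k + gamma *: (A *m xt k - zt k)); rewrite -/psi; case: (psi _).
have EP' k : E k + c * r k ^+ 2 <= env (yt k) (xt k) (zt k) - ps.
  by have := decr _ _ _ _ (Ut k); rewrite -yS -/psi hE lee_fin -/env -/c -/(r k); lra.
have P'P k : env (yt k) (xt k) (zt k) <= env (y k) (x k) (z k).
  have [xt' [zt' [U]]] := tau_acc k; rewrite -ytE in U *.
  rewrite (auglag_envelope f_proper fs g_proper gs (Uk k)) (auglag_envelope f_proper fs g_proper gs U).
  rewrite lee_fin lerN2 -/env => /(le_trans _); apply.
  by rewrite /env (envelope_unique mu_gt0 f_proper fs g_proper gs U (Ut k)).
have EP k : E k + c * r k ^+ 2 <= P k.
  by apply: le_trans (EP' k) _; rewrite /P lerD2r.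
have PE k : P k.+1 <= E k.
  have yE : (psi (y k.+1) <= (E k + ps)%:E)%E by rewrite hE.
  have := env_le _ _ _ _ _ _ (Uk k.+1) yE.
  by rewrite subrr enorm0 expr0n mul0r addr0 /P lerBlDr.
have Er k : E k <= D k.+1 * r k + gamma / 2 * r k ^+ 2.
  have := gap _ _ _ _ _ (Ut k) ysps.
  by rewrite -yS -/psi hE lee_fin -/(D k.+1) -/(r k); lra.
have growE k : (D k.+1 <= e -> al * D k.+1 ^+ 2 <= E k) /\
    (e <= D k.+1 -> al * e * D k.+1 <= E k).
  have yE : (psi (y k.+1) <= (E k + ps)%:E)%E by rewrite hE.
  by have := grow _ _ yE; rewrite addrK.
have P_ge0 k : 0 <= P k.
  have := le_trans (pmin _) (decr _ _ _ _ (Uk k)); rewrite lee_fin -/env -/c.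
  have := mulr_ge0 (ltW c0) (sqr_ge0 (enorm (A *m x k - z k))).
  by rewrite /P; lra.
have D0 : D k @[k --> \oo] --> 0.
  apply: (@descent_cvg _ P E D r c e al (gamma / 2)) => //.
  - by rewrite divr_ge0// ltW.
  - by move=> k; exact: enorm_ge0.
  - by move=> k; exact: enorm_ge0.
  - by move=> k; case: (growE k).
  - by move=> k; case: (growE k).
have PD k : P k <= D k ^+ 2 / (2 * gamma).
  by have := env_le _ _ _ _ _ _ (Uk k) ysps; rewrite /P enormB -/(D k) -/env; lra.
have P0 : P k @[k --> \oo] --> 0.
  apply: (@cvg_le0 _ _ (fun k => (2 * gamma)^-1 * (D k * D k))).
    by apply: nearW => k; rewrite P_ge0/= mulrC -expr2.
  have : (2 * gamma)^-1 * (D k * D k) @[k --> \oo] --> (2 * gamma)^-1 * (0 * 0).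
    by apply: cvgM; [exact: cvg_cst|exact: cvgM].
  by rewrite !mulr0.
(* With [w = y k + gamma s], the square of the distance is at most [2 |w - ys|^2 + 2 gamma^2 |s|^2],
   while [al |w - ys|^2 + c |s|^2 <= P k]; [C] adds the two ratios of coefficients. *)
pose C := 2 / al + 2 * gamma ^+ 2 / c.
have C0 : 0 < C by rewrite addr_gt0// divr_gt0// mulr_gt0// exprn_gt0.
have DP : \forall k \near \oo, D k ^+ 2 <= C * P k.
  have aee : 0 < al * e * e by rewrite !mulr_gt0.
  have Pn : \forall k \near \oo, P k < al * e * e by exact: cvgr_lt P0 _ aee.
  apply: filterS Pn => k Pk.
  have [h1 h2] := grow _ _ (decr _ _ _ _ (Uk k)).
  set s := A *m x k - z k in h1 h2; set w := y k + gamma *: s in h1 h2.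
  rewrite -/c -/env in h1 h2.
  have yw : y k - ys = (w - ys) - gamma *: s.
    by rewrite /w addrAC addrK.
  have := enorm_sqrB_le (w - ys) (gamma *: s).
  rewrite -yw -/(D k) enormZ exprMn real_normK ?num_real//.
  have := sqr_ge0 (enorm (w - ys)); have := sqr_ge0 (enorm s).
  have cs : 0 <= c * enorm s ^+ 2 by rewrite mulr_ge0 ?sqr_ge0 ?(ltW c0).
  (* Otherwise linear growth would give [P k > al e^2]. *)
  have we : enorm (w - ys) <= e.
    rewrite leNgt; apply/negP => we; have := h2 (ltW we).
    have ae0 : 0 < al * e by rewrite mulr_gt0.
    by move: we; rewrite -(ltr_pM2l ae0) => we; rewrite /P in Pk; lra.
  have := h1 we; set W := enorm _ ^+ 2; set S := enorm s ^+ 2 => h S0 W0 DW.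
  apply: le_trans DW _; apply: (@le_trans _ _ (C * (al * W + c * S))).
    have -> : C * (al * W + c * S) = 2 * W + 2 * (gamma ^+ 2 * S)
        + (2 / al * (c * S) + 2 * gamma ^+ 2 / c * (al * W)).
      by rewrite /C; field; rewrite !gt_eqF.
    rewrite lerDl; apply: addr_ge0.
      by apply: mulr_ge0 => //; apply: divr_ge0 (ltW al0).
    apply: mulr_ge0; last exact: mulr_ge0 (ltW al0) W0.
    by apply: divr_ge0 (ltW c0); rewrite mulr_ge0// sqr_ge0.
  by rewrite ler_pM2l// /P; lra.
pose rho k := enorm (y k + d k - ys) / D k.
have rhoD k : rho k * D k = enorm (y k + d k - ys).
  by rewrite /rho divfK// gt_eqF.
have rho_ge0 k : 0 <= rho k by rewrite divr_ge0 ?enorm_ge0.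
have rho2 a : a * (rho k * rho k) @[k --> \oo] --> 0.
  have : a * (rho k * rho k) @[k --> \oo] --> a * (0 * 0).
    by apply: cvgM; [exact: cvg_cst|exact: cvgM].
  by rewrite !mulr0.
have g20 : 0 < 2 * gamma by rewrite mulr_gt0.
have env_d k x' z' : primal_update f g A gamma (y k + d k) x' z' ->
    env (y k + d k) x' z' - ps <= (2 * gamma)^-1 * (rho k * rho k) * D k ^+ 2.
  move=> U; have := env_le _ _ _ _ _ _ U ysps; rewrite enormB -rhoD -/env.
  by rewrite exprMn -expr2 [X in _ -> _ <= X * _]mulrC mulrAC; lra.
(* The envelope gap at [y k + d k] is at most [rho^2 D^2 / (2 gamma)], hence at most
   [C rho^2 / (2 gamma)] times [P k]; the factor is eventually below 1, which is the acceptance test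
   for [beta ^+ 0]. *)
have tau1 : \forall k \near \oo, tau k = 1.
  have rn : \forall k \near \oo, C / (2 * gamma) * (rho k * rho k) < 1.
    exact: cvgr_lt (rho2 _) _ ltr01.
  apply: filterS2 DP rn => k DPk rk.
  have acc : accepted f g A gamma (x k) (z k) (y k) (d k) (beta ^+ 0).
    rewrite /accepted.
    have -> : trial_point A gamma (x k) (z k) (y k) (d k) (beta ^+ 0) = y k + d k.
      by rewrite /trial_point expr0 scale1r subrr mulr0 scale0r addr0.
    have [x' [z' U]] := primal_update_exists A mu_gt0 f_proper f_closed fs
      g_proper g_closed gs gamma_gt0 (y k + d k).
    exists x', z'; split => //.
    rewrite (auglag_envelope f_proper fs g_proper gs (Uk k)) (auglag_envelope f_proper fs g_proper gs U).
    rewrite lee_fin lerN2 -/env -(lerD2r (- ps)); apply: le_trans (env_d _ _ _ U) _.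
    apply: (@le_trans _ _ ((2 * gamma)^-1 * (rho k * rho k) * (C * P k))).
      apply: ler_wpM2l => //; apply: mulr_ge0; last exact: mulr_ge0.
      by rewrite invr_ge0 ltW.
    rewrite -/(P k) mulrA -[leRHS]mul1r ler_wpM2r//.
    rewrite (_ : _ * C = C / (2 * gamma) * (rho k * rho k)); first exact: ltW.
    by rewrite mulrC mulrA.
  apply/eqP; rewrite eq_le; have := tau_max _ _ acc; rewrite expr0 => ->.
  have [i ->] := tau_pow k; rewrite andbT.
  by rewrite exprn_ile1// ltW.
have Erho : \forall k \near \oo,
    E k <= (2 * gamma)^-1 * (rho k * rho k) * D k ^+ 2.
  apply: filterS tau1 => k tk.
  have yd : yt k = y k + d k.
    by rewrite ytE tk /trial_point scale1r subrr mulr0 scale0r addr0.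
  have := Ut k; rewrite yd => /env_d; apply: le_trans; rewrite -yd.
  apply: le_trans (EP' k); rewrite lerDl mulr_ge0 ?sqr_ge0 ?(ltW c0)//.
have DE : \forall k \near \oo, al * D k.+1 ^+ 2 <= E k.
  have Dn : \forall k \near \oo, D k < e by exact: cvgr_lt D0 _ e0.
  by apply: filterS (near_inftyS Dn) => k Dk; case: (growE k) => h _; apply/h/ltW.
have D2 k : 0 < D k ^+ 2 by rewrite exprn_gt0.
(* The dual gap links both distances: [al D_(k+1)^2 <= E_k <= rho_k^2 D_k^2 / (2 gamma)]. *)
have Dratio : D k.+1 / D k @[k --> \oo] --> 0.
  apply: cvg_sqr0.
  apply: (@cvg_le0 _ _ (fun k => al^-1 / (2 * gamma) * (rho k * rho k))); last exact: rho2.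
  apply: filterS2 DE Erho => k h1 h2; rewrite sqr_ge0/= expr_div_n ler_pdivrMr//.
  rewrite -(ler_pM2l al0); apply: le_trans h1 _; apply: le_trans h2 _.
  by rewrite le_eqVlt; apply/orP; left; apply/eqP; field; rewrite !gt_eqF.
have DQ : Qsuperlinear D.
  by split=> // [k|]; [exact: ltW|exact: nearW].
pose a k := fine (psi (y k) - ereal_inf (range psi))%E.
have aS k : a k.+1 = E k by rewrite /a psinf hE -EFinB/= addrK.
have E_gt0 k : 0 < E k.
  have [h1 h2] := growE k; have [/h1|/ltW/h2] := leP (D k.+1) e; apply: lt_le_trans.
    by rewrite mulr_gt0.
  by rewrite !mulr_gt0.
split => //.
- split.
    (* Index 0 is left out, as [psi (y 0)] may be infinite. *)
    exists 1%N => // -[|k] // _; rewrite -/psi psinf hE -EFinB//.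
  change (Qsuperlinear a); split.
  + by move=> k; apply: fine_ge0; rewrite psinf sube_ge0.
  + by exists 1%N => // -[|k] // _; rewrite aS.
  + rewrite -(cvg_shiftS a); apply: (@cvg_le0 _ _ P) => //.
    apply: nearW => k; rewrite aS ltW//=; apply: le_trans (EP k).
    by rewrite lerDl mulr_ge0 ?sqr_ge0 ?(ltW c0).
  (* After the shift the quotient is [E k.+1 / E k]: the numerator is at most
     [rho_(k+1)^2 D_(k+1)^2 / (2 gamma)], and the denominator is at least [al D_(k+1)^2]. *)
  + rewrite -(cvg_shiftS (fun k => a k.+1 / a k)).
    apply: (@cvg_le0 _ _ (fun k => al^-1 / (2 * gamma) * (rho k.+1 * rho k.+1))).
      apply: filterS2 DE (near_inftyS Erho) => k h1 h2.
      rewrite !aS divr_ge0 ?(ltW (E_gt0 _))//= ler_pdivrMr//.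
      apply: le_trans h2 _.
      have rr : 0 <= al^-1 / (2 * gamma) * (rho k.+1 * rho k.+1).
        apply: mulr_ge0; last exact: mulr_ge0.
        by apply: divr_ge0; rewrite ?invr_ge0 ltW.
      apply: le_trans (ler_wpM2l rr h1).
      by rewrite le_eqVlt; apply/orP; left; apply/eqP; field; rewrite !gt_eqF.
    by rewrite (cvg_shiftS (fun k => al^-1 / (2 * gamma) * (rho k * rho k))).
(* The added 1 keeps the majorant [K * D k] positive even when [A = 0], as [Qsuperlinear]
   demands. *)
- pose K := opnorm A / mu + 1.
  have K0 : 0 <= opnorm A / mu by rewrite divr_ge0 ?opnorm_ge0 ?ltW.
  have K1 : 0 < K by rewrite ltr_pwDr.
  exists (fun k => K * D k).
    split.
    + by move=> k; rewrite mulr_ge0 ?(ltW K1) ?(ltW (D_gt0 k)).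
    + by apply: nearW => k; rewrite mulr_gt0.
    + by rewrite -(mulr0 K); apply: cvgM => //; exact: cvg_cst.
    + under eq_fun do rewrite -mulf_div divff ?gt_eqF// mul1r.
      exact: Dratio.
  move=> k; rewrite -x0xs.
  apply: le_trans (primal_update_lipschitz mu_gt0 f_proper fs g_proper gs (Uk k) U0) _.
  by rewrite ler_wpM2r ?enorm_ge0// lerDl.
Qed.
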